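(* Let $(X,d)$ be a controlled metric type space with control function $\alpha : X\times X\to[1,\infty)$ such that $\sup_{u,v\in X}\alpha(u,v)$ exists (is finite) and equals $k$. Let $r\ge 0$ be a real number and let $\{x_n\}_{n\in\mathbb N}$ be a sequence in $X$ that is $r$-convergent to $x\in X$. If $\{\xi_n\}_{n\in\mathbb N}$ is a sequence in $LIM^{r}x_n$ converging to $\xi\in X$, then $\{x_n\}$ is $rk$-convergent to $\xi$.
   Context: A controlled metric type space is a nonempty set $X$ with functions $\alpha: X\times X\to[1,\infty)$ and $d:X\times X\to[0,\infty)$ such that for all $x,y,z\in X$: $d(x,y)=0$ iff $x=y$; $d(x,y)=d(y,x)$; and $d(x,y)\le \alpha(x,z)d(x,z)+\alpha(z,y)d(z,y)$. (No symmetry of $\alpha$ is assumed.) A sequence $\{x_n\}$ in $X$ converges to $x$ if for every $\varepsilon>0$ there is $K\in\mathbb N$ with $d(x_n,x)<\varepsilon$ for all $n\ge K$. For a real $\rho\ge0$, $\{x_n\}$ is $\rho$-convergent (rough convergent of roughness degree $\rho$) to $x\in X$ if for every $\varepsilon>0$ there is $n_0\in\mathbb N$ with $d(x_n,x)<\rho+\varepsilon$ for all $n\ge n_0$. The $\rho$-limit set $LIM^{\rho}x_n$ is the set of all $x\in X$ to which $\{x_n\}$ is $\rho$-convergent. *)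

(* Defs.v *)
From Stdlib Require Import Reals.
Local Open Scope R_scope.

(* No symmetry of [alpha] is required. *)
Record controlled_metric_type (X : Type) (alpha d : X -> X -> R) : Prop := {
  cmt_nonempty : inhabited X;
  cmt_alpha_ge1 : forall x y, 1 <= alpha x y;
  cmt_dist_ge0 : forall x y, 0 <= d x y;
  cmt_dist_eq0 : forall x y, d x y = 0 <-> x = y;
  cmt_dist_sym : forall x y, d x y = d y x;
  cmt_dist_tri : forall x y z,
    d x y <= alpha x z * d x z + alpha z y * d z y
}.

Definition converges {X : Type} (d : X -> X -> R) (u : nat -> X) (x : X) : Prop :=
  forall eps : R, 0 < eps ->
  exists K : nat, forall n : nat, (K <= n)%nat -> d (u n) x < eps.

(* Used only for [0 <= rho]. *)
Definition rough_converges {X : Type} (d : X -> X -> R) (rho : R)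
    (u : nat -> X) (x : X) : Prop :=
  forall eps : R, 0 < eps ->
  exists n0 : nat, forall n : nat, (n0 <= n)%nat -> d (u n) x < rho + eps.

Definition LIM {X : Type} (d : X -> X -> R) (rho : R) (u : nat -> X) : X -> Prop :=
  fun x => rough_converges d rho u x.

Definition control_values {X : Type} (alpha : X -> X -> R) : R -> Prop :=
  fun a => exists u v : X, a = alpha u v.

(* Main.v *)
Require Import Defs.
From Stdlib Require Import Reals Lra.
Local Open Scope R_scope.

(** A single term [xi_ m] close to [xi] serves as intermediate point: the controlled triangle
    inequality through it, with both coefficients bounded by [k], bounds the distance from [xs n] to
    [xi] by k(r + delta) + k delta for large [n]. *)

Theorem theorem3p14 (X : Type) (alpha d : X -> X -> R)
  (HX : controlled_metric_type X alpha d)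
  (k : R) (Hk : is_lub (control_values alpha) k)
  (r : R) (Hr : 0 <= r)
  (xs : nat -> X) (x : X) (Hx : rough_converges d r xs x)
  (xi_ : nat -> X) (xi : X)
  (Hxi_ : forall n : nat, LIM d r xs (xi_ n))
  (Hxi : converges d xi_ xi) :
  rough_converges d (r * k) xs xi.
Proof.
  assert (alpha_le_k : forall u v, alpha u v <= k).
  { intros u v. apply (proj1 Hk). exists u, v. reflexivity. }
  (* Positivity of [k] allows dividing by it and keeps inequalities strict after scaling. *)
  assert (k_ge1 : 1 <= k).
  { apply Rle_trans with (alpha x x); [apply (cmt_alpha_ge1 _ _ _ HX) | apply alpha_le_k]. }
  intros eps Heps.
  (* Each of the two legs contributes an excess [k * delta]; together they make [eps]. *)
  set (delta := eps / (2 * k)).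
  assert (delta_pos : 0 < delta) by (apply Rdiv_lt_0_compat; lra).
  assert (k_delta : k * delta = eps / 2) by (unfold delta; field; lra).
  (* The index [m] is fixed before [n0], which depends on it. *)
  destruct (Hxi delta delta_pos) as [m Hm].
  specialize (Hm m (le_n m)).
  destruct (Hxi_ m delta delta_pos) as [n0 Hn0].
  exists n0. intros n Hn. specialize (Hn0 n Hn).
  (* The uniform factor [k] removes the dependence of the coefficients on [n] and [m]. *)
  assert (scaled_le : forall u v y z, alpha u v * d y z <= k * d y z).
  { intros u v y z. apply Rmult_le_compat_r;
      [apply (cmt_dist_ge0 _ _ _ HX) | apply alpha_le_k]. }
  pose proof (cmt_dist_tri _ _ _ HX (xs n) xi (xi_ m)) as tri.
  pose proof (scaled_le (xs n) (xi_ m) (xs n) (xi_ m)) as near_xs.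
  pose proof (scaled_le (xi_ m) xi (xi_ m) xi) as near_xi.
  assert (k * d (xs n) (xi_ m) < k * (r + delta)) by (apply Rmult_lt_compat_l; lra).
  assert (k * d (xi_ m) xi < k * delta) by (apply Rmult_lt_compat_l; lra).
  lra.
Qed.
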